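(* Let $R$ be any matrix $R(\theta)$, $0\le\theta\le\pi$, in one of the following three families of $(2,3,1)$-$R$-matrices: (a) $$R(\theta)=\frac{1}{\sqrt2}\begin{pmatrix}1&0&1&0\\0&i&0&e^{i\theta}\\-i&0&i&0\\0&-ie^{-i\theta}&0&1\end{pmatrix}\oplus\frac{1}{\sqrt2}\begin{pmatrix}i&0&e^{i\theta}&0\\0&1&0&-e^{2i\theta}\\-ie^{-i\theta}&0&1&0\\0&ie^{-2i\theta}&0&i\end{pmatrix},$$ (b) $$R(\theta)=\frac{1}{\sqrt2}\begin{pmatrix}1&0&1&0\\0&i&0&e^{i\theta}\\-1&0&1&0\\0&e^{-i\theta}&0&i\end{pmatrix}\oplus\frac{1}{\sqrt2}\begin{pmatrix}i&0&e^{i\theta}&0\\0&1&0&-e^{2i\theta}\\ e^{-i\theta}&0&i&0\\0&e^{-2i\theta}&0&1\end{pmatrix},$$ (c) $$R(\theta)=\frac{1}{\sqrt2}\begin{pmatrix}1&0&1&0\\0&1&0&e^{i\theta}\\-1&0&1&0\\0&-e^{-i\theta}&0&1\end{pmatrix}\oplus\frac{1}{\sqrt2}\begin{pmatrix}1&0&-e^{i\theta}&0\\0&1&0&-e^{2i\theta}\\ e^{-i\theta}&0&1&0\\0&e^{-2i\theta}&0&1\end{pmatrix}.$$ Then $R$ satisfies the far commutativity condition, and thus yields a unitary representation of the braid group $B_n$ on $(\mathbb{C}^2)^{\otimes(n+1)}$ given by $\sigma_i\mapsto R_{\sigma_i}$, $1\le i\le n-1$.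
   Context: $\otimes$ is the Kronecker product; $I_2$ is the $2\times2$ identity; $X\oplus Y$ denotes the block diagonal matrix $\begin{pmatrix}X&0\\0&Y\end{pmatrix}$. A $(2,3,1)$-$R$-matrix is an invertible $8\times 8$ complex matrix $R$ (an operator on $(\mathbb{C}^2)^{\otimes 3}$) satisfying the $(2,3,1)$-generalized Yang-Baxter equation $(R\otimes I_2)(I_2\otimes R)(R\otimes I_2)=(I_2\otimes R)(R\otimes I_2)(I_2\otimes R)$. The $n$-strand braid group $B_n$ is presented by generators $\sigma_1,\dots,\sigma_{n-1}$ with relations $\sigma_i\sigma_{i+1}\sigma_i=\sigma_{i+1}\sigma_i\sigma_{i+1}$ for $1\le i\le n-2$ and $\sigma_i\sigma_j=\sigma_j\sigma_i$ for $|i-j|\ge2$. For a $(2,3,1)$-$R$-matrix $R$ and for $B_n$, set $R_{\sigma_i}=I_2^{\otimes(i-1)}\otimes R\otimes I_2^{\otimes(n-i-1)}$, acting on $(\mathbb{C}^2)^{\otimes(n+1)}$. A $(2,3,1)$-$R$-matrix $R$ satisfies the far commutativity condition if $R_{\sigma_1}R_{\sigma_3}=R_{\sigma_3}R_{\sigma_1}$ for the braid group $B_4$, i.e. $(R\otimes I_2\otimes I_2)(I_2\otimes I_2\otimes R)=(I_2\otimes I_2\otimes R)(R\otimes I_2\otimes I_2)$ on $(\mathbb{C}^2)^{\otimes5}$. *)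

(* Defs.v *)
From HB Require Import structures.
From mathcomp Require Import all_boot all_order all_algebra.
From mathcomp Require Import generic_quotient complex mxtens spectral.
From mathcomp Require Import boolp reals trigo.

Set Implicit Arguments.
Unset Strict Implicit.
Unset Printing Implicit Defensive.

Import Order.TTheory GRing.Theory Num.Theory.
Local Open Scope ring_scope.
Local Open Scope complex_scope.
Local Open Scope quotient_scope.

(* The letter [(x, true)] stands for x and [(x, false)] for x^-1. *)
Definition word (X : choiceType) : Type := seq (X * bool).
HB.instance Definition _ (X : choiceType) := Choice.on (word X).

Definition inv_letter (X : choiceType) (a : X * bool) : X * bool := (a.1, ~~ a.2).

Definition inv_word (X : choiceType) (w : word X) : word X :=
  rev (map (@inv_letter X) w).

(* Equality in the group <X | u = v whenever rel u v>. *)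
Inductive word_eq (X : choiceType) (rel : word X -> word X -> Prop) :
    word X -> word X -> Prop :=
| word_eq_refl w : word_eq rel w w
| word_eq_sym u v : word_eq rel u v -> word_eq rel v u
| word_eq_trans u v w : word_eq rel u v -> word_eq rel v w -> word_eq rel u w
| word_eq_cancel u v a : word_eq rel (u ++ a :: inv_letter a :: v) (u ++ v)
| word_eq_rel u v x y : rel x y -> word_eq rel (u ++ x ++ v) (u ++ y ++ v).

Section PresentedGroup.
Variables (X : choiceType) (rel : word X -> word X -> Prop).
Implicit Types u v w : word X.

Lemma word_eq_catl u v w : word_eq rel v w -> word_eq rel (u ++ v) (u ++ w).
Proof.
elim=> [?|? ? _|? ? ? _ ih1 _ ih2|u1 u2 a|u1 u2 x y xy].
- exact: word_eq_refl.
- exact: word_eq_sym.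
- exact: word_eq_trans ih1 ih2.
- by rewrite !catA; apply: word_eq_cancel.
- by rewrite !(catA u); apply: word_eq_rel.
Qed.

Lemma word_eq_catr u v w : word_eq rel u v -> word_eq rel (u ++ w) (v ++ w).
Proof.
elim=> [?|? ? _|? ? ? _ ih1 _ ih2|u1 u2 a|u1 u2 x y xy].
- exact: word_eq_refl.
- exact: word_eq_sym.
- exact: word_eq_trans ih1 ih2.
- by rewrite -!catA; apply: word_eq_cancel.
- by rewrite -!catA; apply: word_eq_rel.
Qed.

Lemma inv_letterK : involutive (@inv_letter X).
Proof. by case=> x b; rewrite /inv_letter /= negbK. Qed.

Lemma inv_wordK : involutive (@inv_word X).
Proof.
move=> w; rewrite /inv_word map_rev revK -map_comp map_id_in // => a _.
exact: inv_letterK.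
Qed.

Lemma word_eq_catV w : word_eq rel (w ++ inv_word w) [::].
Proof.
elim: w => [|a w ih]; first exact: word_eq_refl.
have -> : (a :: w) ++ inv_word (a :: w) =
    [:: a] ++ (w ++ inv_word w) ++ [:: inv_letter a].
  by rewrite /inv_word /= rev_cons -cats1 -catA.
apply: (word_eq_trans (v := [:: a] ++ [::] ++ [:: inv_letter a])).
  by apply: word_eq_catl; apply: word_eq_catr.
exact: (word_eq_cancel rel [::] [::] a).
Qed.

Lemma word_eq_Vcat w : word_eq rel (inv_word w ++ w) [::].
Proof. by rewrite -{2}(inv_wordK w); apply: word_eq_catV. Qed.

Lemma word_eq_inv u v : word_eq rel u v -> word_eq rel (inv_word u) (inv_word v).
Proof.
move=> uv; apply: (word_eq_trans (v := inv_word u ++ v ++ inv_word v)).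
  rewrite -{1}[inv_word u]cats0; apply: word_eq_catl.
  exact/word_eq_sym/word_eq_catV.
apply: (word_eq_trans (v := inv_word u ++ u ++ inv_word v)).
  by apply: word_eq_catl; apply: word_eq_catr; apply: word_eq_sym.
by rewrite catA; apply: word_eq_catr (word_eq_Vcat u).
Qed.

Definition word_eqb u v : bool := `[< word_eq rel u v >].

Lemma word_eqb_refl : reflexive word_eqb.
Proof. by move=> w; apply/asboolP; apply: word_eq_refl. Qed.

Lemma word_eqb_sym : symmetric word_eqb.
Proof. by move=> u v; apply/asboolP/asboolP; apply: word_eq_sym. Qed.

Lemma word_eqb_trans : transitive word_eqb.
Proof.
by move=> v u w /asboolP uv /asboolP vw; apply/asboolP/(word_eq_trans uv vw).
Qed.

Canonical word_equiv := EquivRel word_eqb word_eqb_refl word_eqb_sym word_eqb_trans.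

Definition presented_group : Type := {eq_quot word_equiv}.
HB.instance Definition _ := Choice.on presented_group.
HB.instance Definition _ := EqQuotient.on presented_group.

Definition word_class w : presented_group := \pi_presented_group w.

Lemma word_classP u v : word_class u = word_class v <-> word_eq rel u v.
Proof. by split=> [/eqmodP/asboolP|uv]; last apply/eqmodP/asboolP. Qed.

Lemma word_class_repr (x : presented_group) : word_class (repr x) = x.
Proof. exact: reprK. Qed.

Definition presented_one : presented_group := word_class [::].
Definition presented_mul (x y : presented_group) : presented_group :=
  word_class (repr x ++ repr y).
Definition presented_inv (x : presented_group) : presented_group :=
  word_class (inv_word (repr x)).

Lemma presented_mulE u v :
  presented_mul (word_class u) (word_class v) = word_class (u ++ v).
Proof.
apply/word_classP; apply: (word_eq_trans (v := repr (word_class u) ++ v)).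
  by apply/word_eq_catl/word_classP; rewrite word_class_repr.
by apply/word_eq_catr/word_classP; rewrite word_class_repr.
Qed.

Lemma presented_invE u : presented_inv (word_class u) = word_class (inv_word u).
Proof. by apply/word_classP/word_eq_inv/word_classP; rewrite word_class_repr. Qed.

Lemma presented_mulA : associative presented_mul.
Proof.
move=> x y z; rewrite -(word_class_repr x) -(word_class_repr y) -(word_class_repr z).
by rewrite !presented_mulE catA.
Qed.

Lemma presented_mul1 : left_id presented_one presented_mul.
Proof. by move=> x; rewrite -(word_class_repr x) presented_mulE. Qed.

Lemma presented_mulr1 : right_id presented_one presented_mul.
Proof. by move=> x; rewrite -(word_class_repr x) presented_mulE cats0. Qed.

Lemma presented_mulV : left_inverse presented_one presented_inv presented_mul.
Proof.
move=> x; rewrite -(word_class_repr x) presented_invE presented_mulE.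
exact/word_classP/word_eq_Vcat.
Qed.

Lemma presented_mulrV : right_inverse presented_one presented_inv presented_mul.
Proof.
move=> x; rewrite -(word_class_repr x) presented_invE presented_mulE.
exact/word_classP/word_eq_catV.
Qed.

HB.instance Definition _ := isGroup.Build presented_group
  presented_mulA presented_mul1 presented_mulr1 presented_mulV presented_mulrV.

Definition presented_gen (x : X) : presented_group := word_class [:: (x, true)].

End PresentedGroup.

(* Generators are indexed from 0: [i : 'I_n.-1] stands for sigma_(i+1). *)
Definition letter (n : nat) (i : 'I_n.-1) : 'I_n.-1 * bool := (i, true).

Inductive braid_rel (n : nat) : word 'I_n.-1 -> word 'I_n.-1 -> Prop :=
| braid_rel_adjacent (i j : 'I_n.-1) : j = i.+1 :> nat ->
    braid_rel [:: letter i; letter j; letter i] [:: letter j; letter i; letter j]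
| braid_rel_far (i j : 'I_n.-1) : (i.+2 <= j)%N || (j.+2 <= i)%N ->
    braid_rel [:: letter i; letter j] [:: letter j; letter i].

Definition braid_group (n : nat) : groupType := presented_group (@braid_rel n).

Definition sigma (n : nat) (i : 'I_n.-1) : braid_group n :=
  presented_gen (@braid_rel n) i.

Definition unitary_rep (C : numClosedFieldType) (G : groupType) (d : nat)
    (rho : G -> 'M[C]_d) : Prop :=
  [/\ rho 1%g = 1%:M,
      forall x y : G, rho (x * y)%g = rho x *m rho y
    & forall x : G, rho x \is unitarymx].

Section GeneralizedYangBaxter.
Variable C : numClosedFieldType.

(* The Kronecker products below have dimensions such as 8 * 2 and 2 * 8, which
   are convertible to each other. *)
Definition gybe231 (M : 'M[C]_8) : Prop :=
  let I2 : 'M[C]_2 := 1%:M in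
  let R1 : 'M[C]_16 := M *t I2 in
  let R2 : 'M[C]_16 := I2 *t M in
  R1 *m R2 *m R1 = R2 *m R1 *m R2.

Definition R_matrix231 (M : 'M[C]_8) : Prop := M \in unitmx /\ gybe231 M.

Definition far_commutative (M : 'M[C]_8) : Prop :=
  let I2 : 'M[C]_2 := 1%:M in
  let R1 : 'M[C]_32 := M *t I2 *t I2 in
  let R3 : 'M[C]_32 := I2 *t I2 *t M in
  R1 *m R3 = R3 *m R1.

Lemma strand_dim (n : nat) (i : 'I_n.-1) :
  (2 ^ i * 8 * 2 ^ (n - i.+2) = 2 ^ n.+1)%N.
Proof.
rewrite -[8%N]/(2 ^ 3)%N -!expnD; congr (2 ^ _)%N.
by case: n i => [|[|n]] [] //= i lt_in; rewrite addnAC !addnS subSS subSS addn0 subnKC.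
Qed.

Definition R_sigma (n : nat) (M : 'M[C]_8) (i : 'I_n.-1) : 'M[C]_(2 ^ n.+1) :=
  castmx (strand_dim i, strand_dim i)
    ((1%:M : 'M[C]_(2 ^ i)) *t M *t (1%:M : 'M[C]_(2 ^ (n - i.+2)))).

End GeneralizedYangBaxter.

Section Families.
Variable K : realType.
Local Notation C := K[i].

Definition expi (t : K) : C := cos t +i* sin t.

Definition mx4 (s : seq (seq C)) : 'M[C]_4 :=
  \matrix_(i, j) nth 0 (nth [::] s i) j.

Definition sum_blocks (A B : 'M[C]_4) : 'M[C]_8 :=
  block_mx ((sqrtC 2)^-1 *: A) 0 0 ((sqrtC 2)^-1 *: B).

Definition R_a (t : K) : 'M[C]_8 :=
  sum_blocks
    (mx4 [:: [:: 1;     0;                  1;  0];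
             [:: 0;     'i;                 0;  expi t];
             [:: - 'i;  0;                  'i; 0];
             [:: 0;     - 'i * expi (- t);  0;  1]])
    (mx4 [:: [:: 'i;               0;                      expi t; 0];
             [:: 0;                1;                      0;      - expi (2 * t)];
             [:: - 'i * expi (- t); 0;                     1;      0];
             [:: 0;                'i * expi (- (2 * t));  0;      'i]]).

Definition R_b (t : K) : 'M[C]_8 :=
  sum_blocks
    (mx4 [:: [:: 1;   0;           1; 0];
             [:: 0;   'i;          0; expi t];
             [:: - 1; 0;           1; 0];
             [:: 0;   expi (- t);  0; 'i]])
    (mx4 [:: [:: 'i;         0;                 expi t; 0];
             [:: 0;          1;                 0;      - expi (2 * t)];
             [:: expi (- t); 0;                 'i;     0];
             [:: 0;          expi (- (2 * t));  0;      1]]).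

Definition R_c (t : K) : 'M[C]_8 :=
  sum_blocks
    (mx4 [:: [:: 1;   0;             1; 0];
             [:: 0;   1;             0; expi t];
             [:: - 1; 0;             1; 0];
             [:: 0;   - expi (- t);  0; 1]])
    (mx4 [:: [:: 1;          0;                 - expi t; 0];
             [:: 0;          1;                 0;        - expi (2 * t)];
             [:: expi (- t); 0;                 1;        0];
             [:: 0;          expi (- (2 * t));  0;        1]]).

End Families.

(* Main.v *)
Require Import Defs.
From mathcomp Require Import all_boot all_order all_algebra.
From mathcomp Require Import complex spectral reals trigo.
From mathcomp Require Import mxtens ring zify.
Import Order.TTheory GRing.Theory Num.Theory.
Local Open Scope ring_scope.
Local Open Scope complex_scope.

(** Write a basis vector of (C^2)^{(x)3} as |abc> with bits a, b, c.  The three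
    families share one structural feature: each matrix M preserves the outer
    bits a and c, and acts on the middle bit b by a 2x2 matrix [gate M a c]
    which depends on the outer bits.  Thus R_{sigma_i} changes bit number i+1
    only, in a way which depends only on that bit and on the bits i and i+2.

    - Far commutativity then holds for every such matrix: R_{sigma_1} changes
      bit 2 under the control of bits 1 and 3, R_{sigma_3} changes bit 4 under
      the control of bits 3 and 5, and neither changes a bit which the other
      one depends on ([controlled_far]).
    - On (C^2)^{(x)4} the outer bits are preserved by both sides of the
      Yang-Baxter equation, which becomes the scalar identity [star_triangle]
      between sums of two products of three gate entries
      ([star_triangle_gybe]).  For the three families it is a finite check, up
      to the relations i^2 = -1 and e^{it} e^{-it} = 1.
    - M is unitary as soon as its four gates are ([controlled_unitary]); the
      factor 1/sqrt 2 normalises their rows.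

    The far-commutation relation and the Yang-Baxter equation on five and four
    tensor factors give the braid relations on n+1 factors after tensoring with
    identities; when |i - j| >= 3, the two operators act on disjoint factors.
    Finally, unitary matrices satisfying the defining relations of a presented
    group extend to a unitary representation of the group
    ([presented_group_rep]). *)

Set Implicit Arguments.
Unset Strict Implicit.
Unset Printing Implicit Defensive.

(** * Unitary representations of presented groups *)

Section PresentedRep.
Local Open Scope sesquilinear_scope.
Variables (C : numClosedFieldType) (d : nat) (X : choiceType).
Variable f : X -> 'M[C]_d.
Hypothesis f_unitary : forall x, f x \is unitarymx.

(** The image of a letter; an inverse letter goes to the adjoint matrix. *)
Definition letter_mx (a : X * bool) : 'M[C]_d := if a.2 then f a.1 else (f a.1)^t*.

(** The image of a word, in the order in which the group multiplies. *)
Definition word_mx (w : word X) : 'M[C]_d :=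
  foldr (fun a P => letter_mx a *m P) 1%:M w.

Lemma letter_mx_unitary a : letter_mx a \is unitarymx.
Proof. by case: a => x [] /=; rewrite /letter_mx /= ?trmxC_unitary. Qed.

Lemma letter_mxV a : letter_mx a *m letter_mx (inv_letter a) = 1%:M.
Proof.
case: a => x []; rewrite /letter_mx /=; first exact/unitarymxP.
by rewrite -[X in X *m _]mul1mx (mulmxKtV _ (f_unitary x)).
Qed.

Lemma word_mx_cat u v : word_mx (u ++ v) = word_mx u *m word_mx v.
Proof. by elim: u => [|a u ih] /=; rewrite ?mul1mx // ih mulmxA. Qed.

Lemma word_mx_unitary w : word_mx w \is unitarymx.
Proof.
elim: w => [|a w ih] /=; last exact: mul_unitarymx (letter_mx_unitary a) ih.
by apply/unitarymxP; rewrite trmx1 map_mx1 mul1mx.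
Qed.

Variable rel : word X -> word X -> Prop.
Hypothesis f_rel : forall u v, rel u v -> word_mx u = word_mx v.

Lemma word_mx_eq u v : word_eq rel u v -> word_mx u = word_mx v.
Proof.
elim=> {u v} [//|u v _ -> //|u v w _ -> _ -> //|u v a|u v x y xy].
  by rewrite !word_mx_cat /= (mulmxA (letter_mx a)) letter_mxV mul1mx.
by rewrite !word_mx_cat (f_rel xy).
Qed.

(** Unitary matrices that satisfy the relations of a presentation define a
    unitary representation of the presented group. *)
Lemma presented_group_rep : exists rho : presented_group rel -> 'M[C]_d,
  unitary_rep rho /\ forall x, rho (presented_gen rel x) = f x.
Proof.
pose rho (g : presented_group rel) := word_mx (repr g).
have rhoE w : rho (word_class rel w) = word_mx w.
  by apply: word_mx_eq; apply/word_classP; rewrite word_class_repr.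
exists rho; split; last by move=> x; rewrite rhoE /= mulmx1.
split=> [|g h|g]; first exact: rhoE.
  by rewrite -[g]word_class_repr -[h]word_class_repr
     (presented_mulE rel (repr g) (repr h) : (_ * _)%g = _) !rhoE word_mx_cat.
exact: word_mx_unitary.
Qed.

End PresentedRep.

(** * Tensor products of square matrices and the braid relations *)

Section SquareMatrices.
Variable R : comPzRingType.

(** Square matrices of all sizes.  In this type the tensor product is
    associative as an equation, with no cast between the sizes. *)
Definition sqmx : Type := {n : nat & 'M[R]_n}.
Definition sq n (A : 'M[R]_n) : sqmx := Tagged (fun n => 'M[R]_n) A.

Definition sqtens (A B : sqmx) : sqmx := sq (tagged A *t tagged B).

Lemma sq_inj n : injective (@sq n).
Proof. by move=> A B; apply: eq_from_Tagged. Qed.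

Lemma sq_castmx m n (e : m = n) (A : 'M[R]_m) : sq (castmx (e, e) A) = sq A.
Proof. by case: n / e; rewrite castmx_id. Qed.

Lemma sq_tens m n (A : 'M[R]_m) (B : 'M[R]_n) : sq (A *t B) = sqtens (sq A) (sq B).
Proof. by []. Qed.

Lemma mxtens_indexA m n p (i : 'I_m) (j : 'I_n) (k : 'I_p) :
  cast_ord (esym (mulnA m n p)) (mxtens_index (mxtens_index (i, j), k)) =
  mxtens_index (i, mxtens_index (j, k)).
Proof. by apply: val_inj => /=; rewrite mulnDl -mulnA addnA. Qed.

Lemma tensmxA m n p q r s (A : 'M[R]_(m, n)) (B : 'M[R]_(p, q)) (D : 'M[R]_(r, s)) :
  castmx (esym (mulnA m p r), esym (mulnA n q s)) (A *t B *t D) = A *t (B *t D).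
Proof.
apply/matrixP => x y; rewrite castmxE /=.
case: (mxtens_indexP x) => i j; case: (mxtens_indexP j) => j1 k.
case: (mxtens_indexP y) => i' j'; case: (mxtens_indexP j') => j1' k'.
by rewrite -!mxtens_indexA !esymK !cast_ordKV !mxtens_indexA !tensmxE mulrA.
Qed.

Lemma sqtensA : associative sqtens.
Proof.
by move=> [m A] [n B] [p D]; rewrite -!sq_tens -tensmxA sq_castmx.
Qed.

Lemma tens1mx1 m n : 1%:M *t 1%:M = 1%:M :> 'M[R]_(m * n).
Proof.
apply/matrixP => x y.
case: (mxtens_indexP x) => i j; case: (mxtens_indexP y) => i' j'.
by rewrite tensmxE !mxE (can_eq (@mxtens_indexK m n)) xpair_eqE -natrM mulnb.
Qed.

Lemma sqtens1 m n :
  sqtens (sq (1%:M : 'M_m)) (sq (1%:M : 'M_n)) = sq (1%:M : 'M_(m * n)).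
Proof. by rewrite -sq_tens tens1mx1. Qed.

Lemma sqtens_expn i j : sqtens (sq (1%:M : 'M_(2 ^ i))) (sq (1%:M : 'M_(2 ^ j))) =
  sq (1%:M : 'M_(2 ^ (i + j))).
Proof. by rewrite sqtens1 expnD. Qed.

Section Amplify.
Variables (a b k N : nat) (e : (a * k * b)%N = N).

(** A acting on the middle factor of a tensor product of dimension a * k * b,
    its size being transported to N. *)
Definition amplify (A : 'M[R]_k) : 'M[R]_N :=
  castmx (e, e) (1%:M *t A *t 1%:M).

Lemma amplifyM A B : amplify A *m amplify B = amplify (A *m B).
Proof. by rewrite /amplify; case: N / e; rewrite !castmx_id !tensmx_mul !mul1mx. Qed.

Lemma sq_amplify A :
  sq (amplify A) = sqtens (sqtens (sq (1%:M : 'M_a)) (sq A)) (sq (1%:M : 'M_b)).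
Proof. by rewrite sq_castmx. Qed.
End Amplify.

End SquareMatrices.

Lemma amplify_unitary (C : numClosedFieldType) a b k N (e : (a * k * b)%N = N)
    (A : 'M[C]_k) : A \is unitarymx -> amplify e A \is unitarymx.
Proof.
move=> /unitarymxP AA; apply/unitarymxP.
rewrite /amplify; case: N / e; rewrite castmx_id !trmx_tens !map_mxT !trmx1 !map_mx1.
rewrite !tensmx_mul !mul1mx AA; apply: sq_inj.
by rewrite !sq_tens !sqtens1.
Qed.

Section BraidRelations.
Variables (C : numClosedFieldType) (M : 'M[C]_8) (n : nat).
Implicit Types i j : 'I_n.-1.

Lemma sq_R_sigma i : sq (R_sigma M i) =
  sqtens (sqtens (sq (1%:M : 'M_(2 ^ i))) (sq M)) (sq (1%:M : 'M_(2 ^ (n - i.+2)))).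
Proof. exact: sq_castmx. Qed.

Lemma R_sigma_unitary i : M \is unitarymx -> R_sigma M i \is unitarymx.
Proof. exact: amplify_unitary. Qed.

(** For i < j, both [R_sigma M i] and [R_sigma M j] act within the tensor
    factors i+1, ..., j+3 (counted from 1): on the first three of them for i, and
    on the last three for j.  X is any matrix equal to M (x) 1 up to a cast. *)
Lemma R_sigma_pair i j (lt_ij : (i < j)%N) :
  exists e : (2 ^ i * (2 ^ (j - i) * 8) * 2 ^ (n - j.+2) = 2 ^ n.+1)%N,
  [/\ R_sigma M j = amplify e (1%:M *t M) &
      forall X, sq X = sqtens (sq M) (sq (1%:M : 'M_(2 ^ (j - i)))) ->
      R_sigma M i = amplify e X].
Proof.
have e : (2 ^ i * (2 ^ (j - i) * 8) * 2 ^ (n - j.+2) = 2 ^ n.+1)%N.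
  by rewrite mulnA -expnD subnKC 1?ltnW // strand_dim.
exists e; split=> [|X XE]; apply: sq_inj; rewrite sq_R_sigma sq_amplify.
  by rewrite sq_tens !sqtensA sqtens_expn subnKC // ltnW.
rewrite XE -!sqtensA sqtens_expn; congr (sqtens _ (sqtens _ (sq (1%:M : 'M_(2 ^ _))))).
by have := ltn_ord j; lia.
Qed.

Lemma R_sigma_braid i j : gybe231 M -> j = i.+1 :> nat ->
  R_sigma M i *m R_sigma M j *m R_sigma M i = R_sigma M j *m R_sigma M i *m R_sigma M j.
Proof.
move=> yb ji; have lt_ij : (i < j)%N by rewrite ji.
have [e [Rj Ri]] := R_sigma_pair lt_ij.
(* The sizes 8 * 2 and 2 ^ 1 * 8 are convertible, so that no cast is needed. *)
have d1 : (j - i = 1)%N by rewrite ji subSnn.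
move: e Rj Ri; rewrite d1 => e -> /(_ (M *t (1%:M : 'M_2)) erefl) ->.
by rewrite !amplifyM; congr (amplify _ _); apply: yb.
Qed.

Lemma R_sigma_far i j : far_commutative M -> (i.+2 <= j)%N ->
  R_sigma M i *m R_sigma M j = R_sigma M j *m R_sigma M i.
Proof.
move=> far lt_ij; have [e [-> Ri]] := R_sigma_pair (ltnW lt_ij).
have [d2|d3] : (j - i = 2 \/ 3 <= j - i)%N by lia.
  move: e Ri; rewrite d2 => e Ri.
  rewrite (Ri (M *t (1%:M : 'M_2) *t (1%:M : 'M_2))); last first.
    have E : sqtens (sqtens (sq M) (sq (1%:M : 'M_2))) (sq (1%:M : 'M_2)) =
        sqtens (sq M) (sq (1%:M : 'M_(2 * 2))).
      by rewrite -sqtensA sqtens1.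
    exact: E.
  rewrite !amplifyM; congr (amplify _ _).
  have -> : (1%:M : 'M[C]_(2 ^ 2)) = (1%:M : 'M_2) *t (1%:M : 'M_2).
    by rewrite tens1mx1.
  exact: far.
(* The operators act on disjoint factors, with j - i - 3 factors in between. *)
have dE : (8 * 2 ^ (j - i - 3) = 2 ^ (j - i))%N.
  by rewrite -[8%N]/(2 ^ 3)%N -expnD subnKC.
have XE : (8 * 2 ^ (j - i - 3) * 8 = 2 ^ (j - i) * 8)%N by rewrite dE.
rewrite (Ri (castmx (XE, XE) (M *t 1%:M *t 1%:M))); last first.
  rewrite sq_castmx !sq_tens -sqtensA; congr sqtens.
  rewrite sqtens1; congr (sq (1%:M : 'M_ _)); lia.
have -> : 1%:M *t M = castmx (XE, XE) (1%:M *t (1%:M : 'M_(2 ^ (j - i - 3))) *t M).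
  by apply: sq_inj; rewrite sq_castmx !sq_tens sqtens1 dE.
rewrite !amplifyM; congr (amplify _ _).
case: _ / XE; rewrite !castmx_id.
by rewrite !tensmx_mul !mul1mx !mulmx1.
Qed.
End BraidRelations.

(** * Operators that preserve the outer bits *)

(** The index of the basis vector |abc>, the first bit being the most
    significant; likewise [idx4] and [idx5] for four and five bits. *)
Definition idx3 (a b c : 'I_2) : 'I_8 := mxtens_index (mxtens_index (a, b), c).
Definition idx4 (a b c d : 'I_2) : 'I_16 := mxtens_index (idx3 a b c, d).
Definition idx5 (a b c d e : 'I_2) : 'I_32 := mxtens_index (idx4 a b c d, e).

Variant idx3_spec : 'I_8 -> Type := Idx3 a b c : idx3_spec (idx3 a b c).
Variant idx4_spec : 'I_16 -> Type := Idx4 a b c d : idx4_spec (idx4 a b c d).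
Variant idx5_spec : 'I_32 -> Type := Idx5 a b c d e : idx5_spec (idx5 a b c d e).

Lemma idx3P x : idx3_spec x.
Proof.
case: (@mxtens_indexP 4 2 x) => y c; case: (@mxtens_indexP 2 2 y) => a b.
exact: Idx3.
Qed.

Lemma idx4P x : idx4_spec x.
Proof. by case: (@mxtens_indexP 8 2 x) => y d; case: (idx3P y) => a b c; apply: Idx4. Qed.

Lemma idx5P x : idx5_spec x.
Proof. by case: (@mxtens_indexP 16 2 x) => y e; case: (idx4P y) => a b c d; exact: Idx5. Qed.

Lemma idx3_eq a b c a' b' c' :
  (idx3 a b c == idx3 a' b' c') = [&& a == a', b == b' & c == c'].
Proof.
rewrite (can_eq (@mxtens_indexK 4 2)) xpair_eqE (can_eq (@mxtens_indexK 2 2)) xpair_eqE.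
by rewrite andbA.
Qed.

(** The bits may be grouped from the right as well; this is how they appear in
    tensor products whose last factor is M. *)
Lemma idx4E a b c d : @mxtens_index 2 8 (a, idx3 b c d) = idx4 a b c d.
Proof. by apply: val_inj => /=; lia. Qed.

Lemma idx5E a b c d e :
  @mxtens_index 4 8 (@mxtens_index 2 2 (a, b), idx3 c d e) = idx5 a b c d e.
Proof. by apply: val_inj => /=; lia. Qed.

Section RowExpansion.
Variable R : comPzRingType.

(** Row i of A has at most two nonzero entries: it is the combination with
    coefficients u of the basis row vectors of indices g 0 and g 1. *)
Definition row_expansion n (A : 'M[R]_n) (i : 'I_n) (u : 'I_2 -> R) (g : 'I_2 -> 'I_n) :=
  forall j, A i j = \sum_x u x * (g x == j)%:R.

Lemma mul_row_expansion n p (A : 'M[R]_n) i u g (Z : 'M_(n, p)) k :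
  row_expansion A i u g -> (A *m Z) i k = \sum_x u x * Z (g x) k.
Proof.
move=> Ai; rewrite mxE; under eq_bigr do rewrite Ai mulr_suml.
rewrite exchange_big; apply: eq_bigr => x _ /=.
rewrite (bigD1 (g x)) //= eqxx mulr1 big1 ?addr0 // => j /negPf j_ne.
by rewrite eq_sym j_ne mulr0 mul0r.
Qed.

Lemma row_expansion_tensmx1 n p (A : 'M[R]_n) i u g (k : 'I_p) :
  row_expansion A i u g ->
  row_expansion (A *t (1%:M : 'M_p)) (mxtens_index (i, k)) u
    (fun x => mxtens_index (g x, k)).
Proof.
move=> Ai j; case: (mxtens_indexP j) => j1 j2; rewrite tensmxE mxE Ai mulr_suml.
apply: eq_bigr => x _; rewrite (can_eq (@mxtens_indexK _ _)) xpair_eqE.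
by rewrite -mulrA -natrM mulnb.
Qed.

Lemma row_expansion_tens1mx n p (A : 'M[R]_n) i u g (k : 'I_p) :
  row_expansion A i u g ->
  row_expansion ((1%:M : 'M_p) *t A) (mxtens_index (k, i)) u
    (fun x => mxtens_index (k, g x)).
Proof.
move=> Ai j; case: (mxtens_indexP j) => j1 j2; rewrite tensmxE mxE Ai mulr_sumr.
apply: eq_bigr => x _; rewrite (can_eq (@mxtens_indexK _ _)) xpair_eqE.
by rewrite mulrCA -natrM mulnb.
Qed.

End RowExpansion.

(** The Yang-Baxter equation for operators with gates w, read entry by entry:
    a and d are the preserved outer bits, and the two middle bits go from (b, c),
    the row, to (b', c'), the column.  On either side, one middle bit moves first to x, then the other
    one moves, and the first one moves again. *)
Definition star_triangle (R : pzSemiRingType) (w : 'I_2 -> 'I_2 -> 'I_2 -> 'I_2 -> R) : Prop :=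
  forall a b c d b' c',
    \sum_x w a c b x * w x d c c' * w a c' x b' =
    \sum_x w b d c x * w a x b b' * w b' d x c'.

Section Controlled.
Variables (C : numClosedFieldType) (M : 'M[C]_8).

(** M has nonzero entries only between basis vectors with the same outer bits. *)
Definition controlled : Prop := forall a b c a' b' c',
  (a != a') || (c != c') -> M (idx3 a b c) (idx3 a' b' c') = 0.

(** The 2x2 matrix by which M acts on the middle bit when the outer bits are a
    and c; the row index is b and the column index is b'. *)
Definition gate (a c b b' : 'I_2) : C := M (idx3 a b c) (idx3 a b' c).

Hypothesis ctrlM : controlled.

Lemma controlled_row a b c :
  row_expansion M (idx3 a b c) (gate a c b) (fun x => idx3 a x c).
Proof.
move=> j; case: (idx3P j) => a' b' c'.
have [/andP[/eqP<- /eqP<-]|ne] := boolP ((a == a') && (c == c')).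
  rewrite (bigD1 b') //= big1 => [|x /negPf x_ne]; rewrite idx3_eq !eqxx /=.
    by rewrite mulr1 addr0.
  by rewrite x_ne mulr0.
rewrite ctrlM -?negb_and // big1 // => x _.
by rewrite idx3_eq andbCA (negPf ne) andbF mulr0.
Qed.

Local Notation I2 := (1%:M : 'M[C]_2).

Lemma controlled_row16l a b c d :
  row_expansion (M *t I2 : 'M_16) (idx4 a b c d) (gate a c b) (fun x => idx4 a x c d).
Proof. exact: (row_expansion_tensmx1 d (controlled_row a b c)). Qed.

Lemma controlled_row16r a b c d :
  row_expansion (I2 *t M : 'M_16) (idx4 a b c d) (gate b d c) (fun x => idx4 a b x d).
Proof.
move=> j; rewrite -idx4E (row_expansion_tens1mx a (controlled_row b c d)).
by apply: eq_bigr => x _; rewrite -idx4E.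
Qed.

Lemma controlled_row32l a b c d e :
  row_expansion (M *t I2 *t I2 : 'M_32) (idx5 a b c d e) (gate a c b)
    (fun x => idx5 a x c d e).
Proof. exact: (row_expansion_tensmx1 e (controlled_row16l a b c d)). Qed.

Lemma controlled_row32r a b c d e :
  row_expansion (I2 *t I2 *t M : 'M_32) (idx5 a b c d e) (gate c e d)
    (fun x => idx5 a b c x e).
Proof.
have I4 : I2 *t I2 = 1%:M :> 'M_4 := tens1mx1 C 2 2.
move=> j; rewrite I4 -idx5E.
rewrite (row_expansion_tens1mx (@mxtens_index 2 2 (a, b)) (controlled_row c d e)).
by apply: eq_bigr => x _; rewrite -idx5E.
Qed.

Lemma controlled_far : far_commutative M.
Proof.
rewrite /far_commutative /=; apply/matrixP => i k; case: (idx5P i) => a b c d e.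
rewrite (mul_row_expansion _ _ (controlled_row32l a b c d e)).
rewrite (mul_row_expansion _ _ (controlled_row32r a b c d e)).
under eq_bigr do rewrite controlled_row32r mulr_sumr.
under [RHS]eq_bigr do rewrite controlled_row32l mulr_sumr.
by rewrite exchange_big; apply: eq_bigr => x _; apply: eq_bigr => y _; rewrite mulrCA.
Qed.

Lemma star_triangle_gybe : star_triangle gate -> gybe231 M.
Proof.
move=> st; rewrite /gybe231 /=; apply/matrixP => i k; case: (idx4P i) => a b c d.
rewrite -!mulmxA (mul_row_expansion _ _ (controlled_row16l a b c d)).
rewrite (mul_row_expansion _ _ (controlled_row16r a b c d)).
(* The middle bits (b, c) end as (z, y); the identity applies for fixed z, y. *)
transitivity (\sum_y \sum_z (\sum_x gate a c b x * gate x d c y * gate a y x z) *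
    (idx4 a z y d == k)%:R).
  under eq_bigr => x _.
    rewrite (mul_row_expansion _ _ (controlled_row16r a x c d)) mulr_sumr.
    under eq_bigr do rewrite controlled_row16l !mulr_sumr.
    over.
  rewrite exchange_big; apply: eq_bigr => y _; rewrite exchange_big.
  apply: eq_bigr => z _; rewrite mulr_suml; apply: eq_bigr => x _.
  by rewrite !mulrA.
under eq_bigr => y _ do under eq_bigr => z _ do rewrite st.
under [RHS]eq_bigr => x _.
  rewrite (mul_row_expansion _ _ (controlled_row16l a b x d)) mulr_sumr.
  under eq_bigr do rewrite controlled_row16r !mulr_sumr.
  over.
rewrite exchange_big [RHS]exchange_big; apply: eq_bigr => z _.
rewrite [RHS]exchange_big; apply: eq_bigr => y _.
by rewrite mulr_suml; apply: eq_bigr => x _; rewrite !mulrA.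
Qed.

Lemma controlled_unitary :
  (forall a c b b', \sum_x gate a c b x * Num.conj (gate a c b' x) = (b == b')%:R) ->
  M \is unitarymx.
Proof.
move=> gateU; apply/unitarymxP/matrixP => i j; case: (idx3P i) => a b c.
rewrite (mul_row_expansion _ _ (controlled_row a b c)) mxE.
case: (idx3P j) => a' b' c'; rewrite idx3_eq.
under eq_bigr do rewrite !mxE.
have [/andP[/eqP<- /eqP<-]|ne] := boolP ((a == a') && (c == c')).
  by rewrite !eqxx andbT gateU.
rewrite andbCA (negPf ne) andbF big1 // => x _.
by rewrite ctrlM ?conjC0 ?mulr0 // -negb_and eq_sym [c' == c]eq_sym.
Qed.

End Controlled.

(** * The three families *)

Section Families.
Variable K : realType.
Local Notation C := K[i].
Local Notation rt := ((sqrtC 2)^-1 : C).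

Lemma rt_sqr : rt ^+ 2 * 2 = 1.
Proof. by rewrite exprVn sqrtCK mulVf // pnatr_eq0. Qed.

Lemma rt_conj : Num.conj rt = rt.
Proof. by rewrite conj_Creal // rpredV sqrtC_real. Qed.

Lemma expiD (s t : K) : expi (s + t) = expi s * expi t.
Proof. by rewrite /expi cosD sinD; simpc; rewrite [sin s * _ + _]addrC. Qed.

Lemma expiN (t : K) : expi t * expi (- t) = 1.
Proof. by rewrite -expiD subrr /expi cos0 sin0. Qed.

Lemma expi2 (t : K) : expi (2 * t) = expi t ^+ 2.
Proof. by rewrite mulr_natl mulr2n expiD. Qed.

Lemma expi_conj (t : K) : Num.conj (expi t) = expi (- t).
Proof. by rewrite /expi cosN sinN. Qed.

Lemma i_conj : Num.conj 'i%C = - 'i%C :> C.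
Proof. by rewrite complexiE conjCi. Qed.

Lemma expi2N (t : K) : expi (- (2 * t)) = expi (- t) ^+ 2.
Proof. by rewrite -mulrN expi2. Qed.

Lemma sum_blocksE (s t : seq (seq C)) (i j : 'I_8) :
  sum_blocks (mx4 s) (mx4 t) i j =
  if (i < 4)%N then if (j < 4)%N then rt * nth 0 (nth [::] s i) j else 0
  else if (j < 4)%N then 0 else rt * nth 0 (nth [::] t (i - 4)) (j - 4).
Proof.
rewrite /sum_blocks -(@splitK 4 4 i) -(@splitK 4 4 j).
case: (@split 4 4 i) => i1; case: (@split 4 4 j) => j1; rewrite /unsplit.
- by rewrite (@block_mxEul _ 4 4 4 4) !mxE /= !ltn_ord.
- by rewrite (@block_mxEur _ 4 4 4 4) mxE /= ltn_ord.
- by rewrite (@block_mxEdl _ 4 4 4 4) mxE /= ltn_ord.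
by rewrite (@block_mxEdr _ 4 4 4 4) !mxE /= !addKn.
Qed.

(** All entries with row and column of different parities vanish. *)
Definition alternating (s : seq (seq C)) : Prop :=
  forall i j, (i < 4)%N -> (j < 4)%N -> odd i != odd j -> nth 0 (nth [::] s i) j = 0.

Lemma idx3_val (a b c : 'I_2) : idx3 a b c = (a * 4 + (b * 2 + c))%N :> nat.
Proof. rewrite /=; lia. Qed.

Lemma bits_lt4 (b c : 'I_2) : (b * 2 + c < 4)%N.
Proof. by have := ltn_ord b; have := ltn_ord c; lia. Qed.

Lemma sum_blocks_idx3 s t (a b c a' b' c' : 'I_2) :
  sum_blocks (mx4 s) (mx4 t) (idx3 a b c) (idx3 a' b' c') =
  if a == a' then
    rt * nth 0 (nth [::] (if a == 0 then s else t) (b * 2 + c)) (b' * 2 + c')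
  else 0.
Proof.
rewrite sum_blocksE !idx3_val.
have := bits_lt4 b c; have := bits_lt4 b' c'.
move: (b * 2 + c)%N (b' * 2 + c')%N => i j lt_j lt_i.
by case: a => -[|[|[]]] //= la; case: a' => -[|[|[]]] //= la';
   rewrite ?add0n ?lt_i ?lt_j ?ltnNge ?leq_addr ?addKn.
Qed.

Lemma sum_blocks_controlled s t : alternating s -> alternating t ->
  controlled (sum_blocks (mx4 s) (mx4 t)).
Proof.
move=> alt_s alt_t a b c a' b' c'; rewrite sum_blocks_idx3.
case: eqP => //= _ cc'.
have odd_cc' : odd (b * 2 + c) != odd (b' * 2 + c').
  rewrite !oddD !oddM !andbF /=; move: cc'.
  by case: c => -[|[|[]]] //= ?; case: c' => -[|[|[]]].
by case: ifP => _; rewrite ?alt_s ?alt_t ?mulr0 ?bits_lt4.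
Qed.

(** The gates of sqrt 2 times the block matrix of s and t: the outer bit a
    selects the block, and b, c are the bits of the index within the block. *)
Definition block_gate (s t : seq (seq C)) (a c b b' : 'I_2) : C :=
  nth 0 (nth [::] (if a == 0 then s else t) (b * 2 + c)) (b' * 2 + c).

Lemma gate_sum_blocks s t a c b b' :
  gate (sum_blocks (mx4 s) (mx4 t)) a c b b' = rt * block_gate s t a c b b'.
Proof. by rewrite /gate sum_blocks_idx3 eqxx. Qed.

(** Both sides of the star-triangle identity are cubic in the gates, so it may
    be checked without the factor 1/sqrt 2. *)
Lemma sum_blocks_gybe s t : alternating s -> alternating t ->
  star_triangle (block_gate s t) -> gybe231 (sum_blocks (mx4 s) (mx4 t)).
Proof.
move=> alt_s alt_t st; apply: star_triangle_gybe; first exact: sum_blocks_controlled.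
move=> a b c d b' c'.
transitivity (rt ^+ 3 * \sum_x block_gate s t a c b x * block_gate s t x d c c' *
                        block_gate s t a c' x b').
  by rewrite mulr_sumr; apply: eq_bigr => x _; rewrite !gate_sum_blocks; ring.
rewrite st mulr_sumr; apply: eq_bigr => x _; rewrite !gate_sum_blocks; ring.
Qed.

(** Without the factor 1/sqrt 2, the rows of the gates have squared norm 2. *)
Lemma sum_blocks_unitary s t : alternating s -> alternating t ->
  (forall a c b b', \sum_x block_gate s t a c b x * Num.conj (block_gate s t a c b' x) =
                    2 * (b == b')%:R) ->
  sum_blocks (mx4 s) (mx4 t) \is unitarymx.
Proof.
move=> alt_s alt_t gU; apply: controlled_unitary; first exact: sum_blocks_controlled.
move=> a c b b'.
transitivity (rt ^+ 2 * \sum_x block_gate s t a c b x * Num.conj (block_gate s t a c b' x)).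
  rewrite mulr_sumr; apply: eq_bigr => x _.
  by rewrite !gate_sum_blocks rmorphM /= rt_conj; ring.
by rewrite gU mulrA rt_sqr mul1r.
Qed.

Lemma forall_I2 (P : 'I_2 -> Prop) : P 0 -> P 1 -> forall a, P a.
Proof.
move=> P0 P1 [[|[|//]] lt_a].
  by rewrite (_ : Ordinal lt_a = 0) //; apply: val_inj.
by rewrite (_ : Ordinal lt_a = 1) //; apply: val_inj.
Qed.

Lemma sum_I2 (F : 'I_2 -> C) : \sum_x F x = F 0 + F 1.
Proof.
by rewrite !big_ord_recl big_ord0 addr0; congr (_ + F _); apply: val_inj.
Qed.

Variable t : K.

Ltac check_alternating := by move=> [|[|[|[|i]]]] [|[|[|[|j]]]].

(* The entries are polynomials in 'i, expi t and expi (- t).  The rewriting with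
   complexiE turns the imaginary unit of a general closed field into 0 +i* 1,
   as both occur among the entries. *)
Ltac check_star_triangle :=
  rewrite /star_triangle; do 6![apply: forall_I2];
  rewrite !sum_I2 /block_gate /= ?expi2 ?expi2N -?complexiE;
  ring: (expiN t) (sqr_i K).

Ltac check_gates_unitary :=
  do 4![apply: forall_I2]; rewrite !sum_I2 /block_gate /= ?expi2 ?expi2N;
  rewrite ?rmorph0 ?rmorph1 ?(rmorphN, rmorphM) /= ?expi_conj ?opprK -?complexiE ?i_conj;
  ring: (expiN t) (sqr_i K).

Lemma R_a_controlled : controlled (R_a t).
Proof. apply: sum_blocks_controlled; check_alternating. Qed.

Lemma R_a_gybe : gybe231 (R_a t).
Proof.
apply: sum_blocks_gybe; [check_alternating | check_alternating | check_star_triangle].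
Qed.

Lemma R_a_unitary : R_a t \is unitarymx.
Proof.
apply: sum_blocks_unitary; [check_alternating | check_alternating | check_gates_unitary].
Qed.

Lemma R_b_controlled : controlled (R_b t).
Proof. apply: sum_blocks_controlled; check_alternating. Qed.

Lemma R_b_gybe : gybe231 (R_b t).
Proof.
apply: sum_blocks_gybe; [check_alternating | check_alternating | check_star_triangle].
Qed.

Lemma R_b_unitary : R_b t \is unitarymx.
Proof.
apply: sum_blocks_unitary; [check_alternating | check_alternating | check_gates_unitary].
Qed.

Lemma R_c_controlled : controlled (R_c t).
Proof. apply: sum_blocks_controlled; check_alternating. Qed.

Lemma R_c_gybe : gybe231 (R_c t).
Proof.
apply: sum_blocks_gybe; [check_alternating | check_alternating | check_star_triangle].
Qed.

Lemma R_c_unitary : R_c t \is unitarymx.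
Proof.
apply: sum_blocks_unitary; [check_alternating | check_alternating | check_gates_unitary].
Qed.

End Families.

Lemma braid_group_rep (C : numClosedFieldType) (M : 'M[C]_8) (n : nat) :
  M \is unitarymx -> gybe231 M -> far_commutative M ->
  exists rho : braid_group n -> 'M[C]_(2 ^ n.+1),
    unitary_rep rho /\ forall i : 'I_n.-1, rho (sigma i) = R_sigma M i.
Proof.
move=> MU yb far; apply: presented_group_rep => [i|u v]; first exact: R_sigma_unitary.
case=> {u v} i j ij; rewrite /word_mx /= /letter_mx /= !mulmx1.
  by have := R_sigma_braid yb ij; rewrite -!mulmxA.
by case/orP: ij => ij; [|symmetry]; apply: R_sigma_far.
Qed.

Theorem corollary4p3 (K : realType) (theta : K) (M : 'M[K[i]]_8) :
  0 <= theta -> theta <= pi ->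
  [\/ M = R_a theta, M = R_b theta | M = R_c theta] ->
  [/\ R_matrix231 M,
      far_commutative M
    & forall n : nat, (0 < n)%N ->
        exists rho : braid_group n -> 'M[K[i]]_(2 ^ n.+1),
          unitary_rep rho /\ forall i : 'I_n.-1, rho (sigma i) = R_sigma M i].
Proof.
move=> _ _ ME.
have [ctrlM yb MU] : [/\ controlled M, gybe231 M & M \is unitarymx].
  case: ME => ->.
  - by split; [apply: R_a_controlled | apply: R_a_gybe | apply: R_a_unitary].
  - by split; [apply: R_b_controlled | apply: R_b_gybe | apply: R_b_unitary].
  by split; [apply: R_c_controlled | apply: R_c_gybe | apply: R_c_unitary].
have far := controlled_far ctrlM.
split=> // [|n _]; first by split=> //; apply: unitarymx_unit.
exact: braid_group_rep.
Qed.
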